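(* Let $p$ be a prime and $G=\mathrm{PSL}(2,2^p)$. Then the induced solubility graph $\Delta_S(G)$ has a Hamiltonian cycle.
   Context: For a finite group $G$ with soluble radical $R(G)$ (largest soluble normal subgroup), the induced solubility graph $\Delta_S(G)$ is the simple graph with vertex set $G\setminus R(G)$ in which two distinct vertices $x,y$ are adjacent if and only if $\langle x,y\rangle$ is soluble. A Hamiltonian cycle is a cycle visiting each vertex exactly once. *)

(* Defs.v *)
From HB Require Import structures.
From mathcomp Require Import all_boot all_order all_fingroup all_algebra.
From mathcomp Require Import all_solvable all_field.

Set Implicit Arguments.
Unset Strict Implicit.
Unset Printing Implicit Defensive.

Import GroupScope GRing.Theory.

Section LinearGroups.

Variables (n : nat) (F : finFieldType).

Definition SL : {set {'GL_n[F]}} := [set u | \det (GLval u) == 1]%R.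

Lemma SL_group_set : group_set SL.
Proof.
apply/group_setP; split=> [|u v]; first by rewrite inE GL_1E det1.
by rewrite !inE GL_MxE det_mulmx => /eqP-> /eqP->; rewrite mulr1.
Qed.

Canonical SL_group := Group SL_group_set.

(* A subgroup of the type of cosets of 'Z(SL), which itself represents
   'N('Z(SL)) / 'Z(SL) in the general linear group. *)
Definition PSL := (SL_group / 'Z(SL_group))%G.

End LinearGroups.

Section SolubleRadical.

Variables (gT : finGroupType) (G : {group gT}).

Definition soluble_radical : {set gT} :=
  <<\bigcup_(N : {group gT} | (N <| G) && solvable N) N>>.

Canonical soluble_radical_group := [group of soluble_radical].

Lemma soluble_radical_max (N : {group gT}) :
  N <| G -> solvable N -> N \subset soluble_radical.
Proof. by move=> nsN solN; rewrite sub_gen // (bigcup_max N) ?nsN. Qed.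

Lemma soluble_radical_sol_normal :
  soluble_radical <| G /\ solvable soluble_radical.
Proof.
pose P (A : {set gT}) := exists H : {group gT},
  [/\ <<A>> = H, H <| G & solvable H].
suff [H [eqH nH sH]] :
  P (\bigcup_(N : {group gT} | (N <| G) && solvable N) N)
  by rewrite /soluble_radical eqH.
apply: (big_ind P) => [|A B [H [eA nH sH]] [K [eB nK sK]]|N /andP[nN sN]].
- by exists 1%G; rewrite gen0 normal1 solvable1.
- exists (H <*> K)%G; split; last 2 first.
  + exact: normalY.
  + have nHK: K \subset 'N(H).
      by apply: subset_trans (normal_norm nH); apply: normal_sub.
    have nsHK: H <| (H <*> K)%G by rewrite /= normalYl.
    by rewrite (series_sol nsHK) sH /= quotientYidl ?quotient_sol.
  + by rewrite /= -eA -eB joing_idl joing_idr.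
- by exists N; rewrite genGid.
Qed.

Definition solubility_vertices : {set gT} := G :\: soluble_radical.

Definition solubility_adj : rel gT := fun x y =>
  [&& x \in solubility_vertices, y \in solubility_vertices,
      x != y & solvable <<[set x; y]>>].

End SolubleRadical.

(* The size bound excludes the degenerate closed walks on at most two
   vertices, which ucycle accepts but which are not cycles of a simple graph. *)
Definition has_hamiltonian_cycle (T : finType) (V : {set T}) (e : rel T) :=
  exists c : seq T, [/\ (2 < size c)%N, ucycle e c & c =i V].

(* Main.v *)
Require Import Defs.
From mathcomp Require Import all_boot all_order all_fingroup all_algebra.
From mathcomp Require Import all_solvable all_field.
From mathcomp Require Import ring.

(** The field F has characteristic 2 and more than two elements. The centre of
    SL(2, F) is trivial, so PSL(2, F) is SL(2, F), and it has no nontrivial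
    soluble normal subgroup: a nontrivial abelian normal subgroup would contain
    an element that commutes with all its conjugates by unipotent matrices
    ([SL2_abelian_normal]). So a Hamiltonian cycle through the nonidentity
    matrices is wanted, two of them being adjacent as soon as they are
    involutions, commute, share an eigenline, or one of them is an involution
    that inverts the other.

    The nonidentity matrices fall into three families. Those of trace 0 are the
    involutions, which form a clique since two involutions generate a dihedral
    group. The split ones have nonzero trace and two eigenlines, that is, two
    fixed points on the projective line. The nonsplit ones have no fixed point.

    Split elements ([split_ham_path]). All elements fixing a given point lie in
    a soluble Borel subgroup, so they form a clique. Running through the
    elements that fix a first point a, finishing with one that fixes a and a
    second point c, allows one to go on with the elements that do not fix a,
    beginning with one that fixes c. Hence there is a Hamiltonian path of the
    split elements that joins an element fixing a to an element fixing b, for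
    any two distinct points a and b.

    Nonsplit elements ([flips_nonsplit_ham_path]). A nonsplit element has few
    neighbours: it commutes with the elements of its torus, and it is inverted
    by #|F| + 1 involutions. The involutions with rows (a, b) and (c, a) where
    b <> 0 are determined by (a, b). Fix delta = 1 / w0, where w0 is not of the
    form z ^ 2 + z, so that F is covered by the values of z ^ 2 + z and their
    translates by w0 ([artin_schreier_index2]), and pair (a, b)
    with (a + delta, b). For every nonsplit torus exactly one of these pairs
    consists of two involutions inverting the torus, so that the pair and the
    torus elements form a clique, and different tori use different pairs. Paths
    through these cliques that begin and end with an involution can be
    concatenated in any order.

    The cycle then runs through the involutions with b = 0, which all fix the
    point (1, 0), next through the cliques above, ending with some involution
    that fixes a point v <> (1, 0), and finally through the split elements from
    one that fixes v to one that fixes (1, 0). *)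

Set Implicit Arguments.
Unset Strict Implicit.
Unset Printing Implicit Defensive.

Import GroupScope GRing.Theory.

(** * Hamiltonian paths in a finite graph *)

Section HamiltonianPaths.

Variables (T : finType) (e : rel T).
Implicit Types (W : {set T}) (P Q : pred T).

(** The end points are only constrained to satisfy P and Q, because the
    concatenation of paths needs to know of them no more than the vertices they
    are adjacent to. *)
Definition ham_path W P Q := exists x s,
  [/\ uniq (x :: s), x :: s =i W, path e x s, P x & Q (last x s)].

Lemma ham_path_weaken W P1 Q1 P2 Q2 :
    {in W, forall x, P1 x -> P2 x} -> {in W, forall x, Q1 x -> Q2 x} ->
  ham_path W P1 Q1 -> ham_path W P2 Q2.
Proof.
move=> sP sQ [x [s [uxs Es pxs Px Qs]]]; exists x, s; split=> //.
  by apply: sP; rewrite // -Es mem_head.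
by apply: sQ; rewrite // -Es mem_last.
Qed.

Lemma ham_path_cat W1 W2 P1 Q1 P2 Q2 :
    ham_path W1 P1 Q1 -> ham_path W2 P2 Q2 -> [disjoint W1 & W2] ->
    {in W1 & W2, forall x y, Q1 x -> P2 y -> e x y} ->
  ham_path (W1 :|: W2) P1 Q2.
Proof.
move=> [x [s [uxs Es pxs P1x Q1s]]] [y [t [uyt Et pyt P2y Q2t]]] dW e12.
exists x, (s ++ y :: t); split=> //; last by rewrite last_cat.
- rewrite -cat_cons cat_uniq uxs uyt andbT.
  by apply/hasPn=> z; rewrite Et => zW2; rewrite /= Es (disjointFl dW).
- by move=> z; rewrite -cat_cons mem_cat Es Et inE.
- by rewrite cat_path pxs /= pyt e12 // -?Es -?Et ?mem_last ?mem_head.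
Qed.

Lemma clique_ham_path W x y :
    x \in W -> y \in W -> x != y -> {in W &, forall u v, u != v -> e u v} ->
  ham_path W (pred1 x) (pred1 y).
Proof.
move=> xW yW neq_xy cliqueW; pose s := rcons (enum (W :\ x :\ y)) y.
have uxs: uniq (x :: s).
  by rewrite /= rcons_uniq enum_uniq mem_rcons inE !mem_enum !inE !eqxx
             (negPf neq_xy).
have Es: x :: s =i W.
  move=> z; rewrite inE mem_rcons inE mem_enum !inE.
  by case: eqVneq => [->|_] //=; case: eqVneq => [->|].
exists x, s; split=> //=; rewrite ?last_rcons ?eqxx //.
suff: sorted e (x :: s) by [].
apply: pairwise_sorted; move: uxs; rewrite uniq_pairwise.
apply: (sub_in_pairwise (P := mem W)); first exact: cliqueW.
by apply/allP=> z; rewrite Es.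
Qed.
(** The paths through the fibres of f can be joined in any order, because their
    end points satisfy P and the vertices satisfying P form a clique. *)
Lemma ham_path_fibres (K : eqType) (f : T -> K) W P :
    W != set0 -> {in W &, forall x y, P x -> P y -> x != y -> e x y} ->
    {in W, forall x, ham_path [set y in W | f y == f x] P P} ->
  ham_path W P P.
Proof.
have [n] := ubnP #|W|; elim: n W => // n IHn W /ltnSE leWn W0 eP hamW.
have [x xW] := set0Pn _ W0; pose A := [set y in W | f y == f x].
have sAW : A \subset W by apply/subsetP=> y; rewrite inE => /andP[].
have [WA0|WA0] := eqVneq (W :\: A) set0.
  suff -> : W = A by apply: hamW.
  by apply/eqP; rewrite eqEsubset sAW -setD_eq0 WA0 eqxx.
have ham_rest : ham_path (W :\: A) P P.
  apply: IHn => //.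
  - rewrite (leq_trans _ leWn) // proper_card // properE subsetDl.
    by apply/subsetPn; exists x; rewrite // !inE xW eqxx.
  - by move=> y z /setDP[yW _] /setDP[zW _]; apply: eP.
  move=> y /setDP[yW yA].
  suff -> : [set z in W :\: A | f z == f y] = [set z in W | f z == f y].
    exact: hamW.
  apply/setP=> z; rewrite !inE; case: (z \in W); rewrite ?andbF ?andbT //=.
  case: (eqVneq (f z) (f y)) => [->|_]; rewrite ?andbF ?andbT //.
  by move: yA; rewrite inE yW /= => ->.
rewrite -[W](setID _ A) (setIidPr sAW).
apply: ham_path_cat (hamW x xW) ham_rest _ _.
  rewrite disjoint_sym disjoints_subset.
  by apply/subsetP=> y; rewrite !inE => /andP[].
move=> y z yA /setDP[zW zA] Py Pz; apply: eP => //; first exact: (subsetP sAW).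
by apply/eqP=> eq_yz; rewrite -eq_yz yA in zA.
Qed.

End HamiltonianPaths.

(** * Soluble groups generated by two elements *)

Section TwoGenerated.
Variable gT : finGroupType.
Implicit Types x y s : gT.
Local Open Scope group_scope.

Lemma solvable_norm_cycle x y :
  y \in 'N(<[x]>) -> solvable <<[set x; y]>>.
Proof.
move=> nxy.
have ->: <<[set x; y]>> = <[x]> <*> <[y]> by rewrite joing_idl joing_idr.
have nyx : <[y]> \subset 'N(<[x]>) by rewrite cycle_subG.
have nsx: <[x]> <| <[x]> <*> <[y]> by rewrite normalYl.
rewrite (series_sol nsx) abelian_sol ?cycle_abelian //=.
by rewrite quotientYidl // quotient_sol // abelian_sol ?cycle_abelian.
Qed.

Lemma solvable_commute x y : commute x y -> solvable <<[set x; y]>>.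
Proof.
move=> cxy; apply: solvable_norm_cycle.
by apply: (subsetP (cent_sub _)); rewrite cent_cycle; apply/cent1P.
Qed.

(** The involution s inverts x, hence it normalises <[x]>. *)
Lemma solvable_inverting s x :
  s ^+ 2 = 1 -> (s * x) ^+ 2 = 1 -> solvable <<[set s; x]>>.
Proof.
move=> s2 sx2; rewrite setUC; apply: solvable_norm_cycle.
have sV: s^-1 = s by apply/eqP; rewrite eq_invg_mul -[X in _ == X]s2.
have sxsx: s * x * s * x = 1 by rewrite -mulgA -[RHS]sx2.
have xs: x ^ s = x^-1.
  apply: (mulgI x); apply: (mulgI s); rewrite conjgE sV mulgV !mulgA sxsx.
  by rewrite mul1g mulg1.
by apply/normP; rewrite -cycleJ xs cycleV.
Qed.

(** The product of two involutions is inverted by each of them. *)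
Lemma solvable_involutions x y :
  x ^+ 2 = 1 -> y ^+ 2 = 1 -> solvable <<[set x; y]>>.
Proof.
move=> x2 y2.
have sol: solvable <<[set x; x * y]>>.
  apply: solvable_inverting; first by [].
  by rewrite mulgA -[x * x]/(x ^+ 2) x2 mul1g.
apply: solvableS sol; rewrite gen_subG subUset !sub1set mem_gen ?set21 //=.
by rewrite -[X in X \in _](mulKg x y) groupM ?groupV ?mem_gen ?set21 ?set22.
Qed.

Definition soladj x y := (x != y) && solvable <<[set x; y]>>.

Lemma soladj_sym x y : soladj x y = soladj y x.
Proof. by rewrite /soladj eq_sym setUC. Qed.

End TwoGenerated.

Arguments soladj {gT} x y.

Local Open Scope ring_scope.

(** * Calculations in characteristic two *)

(** An equation in characteristic two is proved by exhibiting a combination of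
    known equations such that, once everything is moved to the same side with
    plus signs, all the integral coefficients are even. The combination is
    built by [lincomb1] and [lincombD] and added to the goal by [lincomb_eq]. *)
Section CharTwo.

Variable R : comNzRingType.
Hypothesis char2 : 2%N \in [pchar R].
Implicit Types x y a b c : R.

Lemma sum0_eq x y : x + y = 0 -> x = y.
Proof. by move=> /eqP; rewrite addr_eq0 (oppr_pchar2 char2) => /eqP. Qed.

Lemma lincomb1 c x y : x = y -> c * (x + y) = 0.
Proof. by move=> ->; rewrite (addrr_pchar2 char2) mulr0. Qed.

Lemma lincombD a b : a = 0 -> b = 0 -> a + b = 0.
Proof. by move=> -> ->; rewrite addr0. Qed.

Lemma lincomb_eq x y a : a = 0 -> x + y + a = 0 -> x = y.
Proof. by move=> ->; rewrite addr0; apply: sum0_eq. Qed.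

Lemma natr_even n : ~~ odd n -> n%:R = 0 :> R.
Proof.
by move=> /even_halfK <-; rewrite -muln2 natrM (pcharf0 char2) mulr0.
Qed.

End CharTwo.

(** The [ring] tactic uses an equation n = 0 only on monomials whose coefficient
    is exactly n, so all the small even values have to be supplied; moving the
    goal to the form x + y = 0 first keeps the coefficients positive. *)
Ltac ring2 ch :=
  let e2 := fresh in let e4 := fresh in let e6 := fresh in let e8 := fresh in
  have e2 := @natr_even _ ch 2 isT; have e4 := @natr_even _ ch 4 isT;
  have e6 := @natr_even _ ch 6 isT; have e8 := @natr_even _ ch 8 isT;
  apply: (sum0_eq ch); ring: e2 e4 e6 e8.

(** * The Artin-Schreier map of a finite field of characteristic two *)

Section Field2.

Variable F : finFieldType.
Hypothesis char2 : 2%N \in [pchar F].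
Implicit Types x y z w : F.

Lemma square_onto x : exists y, y ^+ 2 = x.
Proof.
have inj2 : injective (fun y : F => y ^+ 2).
  move=> y z /= eq_yz; apply: (sum0_eq char2); apply/eqP.
  rewrite -sqrf_eq0; apply/eqP.
  apply: (lincomb_eq char2 (lincomb1 char2 1 eq_yz)).
  ring2 char2.
by have /codomP[y ->] := injF_onto inj2 x; exists y.
Qed.

Definition artin_schreier z := z ^+ 2 + z.

Lemma artin_schreierD z w :
  artin_schreier (z + w) = artin_schreier z + artin_schreier w.
Proof. rewrite /artin_schreier; ring2 char2. Qed.

Lemma artin_schreier_eq z w :
  artin_schreier z = artin_schreier w -> z = w \/ z = w + 1.
Proof.
move=> eq_zw; have /eqP : (z + w) * (z + w + 1) = 0.
  apply: (lincomb_eq char2 (lincomb1 char2 1 eq_zw)).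
  rewrite /artin_schreier; ring2 char2.
rewrite mulf_eq0 => /orP[] /eqP h; [left | right].
  exact: (sum0_eq char2).
by apply: (sum0_eq char2); rewrite addrA.
Qed.

Lemma card_artin_schreier_image : (#|artin_schreier @: F| * 2 = #|F|)%N.
Proof.
rewrite -sum_nat_const -[RHS]sum1_card.
rewrite [RHS](partition_big artin_schreier [in artin_schreier @: F]) /=;
    last first.
  by move=> z _; apply: imset_f.
apply: eq_bigr => _ /imsetP[z _ ->]; rewrite sum1_card.
have <- : #|[set z; z + 1]| = 2%N.
  by rewrite cards2 -subr_eq0 opprD addrA subrr sub0r oppr_eq0 oner_eq0.
apply: eq_card => y; rewrite !inE /= unfold_in /=.
apply/idP/eqP => [/orP[] /eqP->|/artin_schreier_eq[]->]; rewrite ?eqxx ?orbT //.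
rewrite /artin_schreier; ring2 char2.
Qed.

(** The map is additive with kernel {0, 1}, so its image has index 2 and any w0
    outside the image represents the other coset. *)
Lemma artin_schreier_index2 : exists2 w0,
    w0 != 0 & forall w, (exists z, artin_schreier z = w) \/
                        (exists z, artin_schreier z = w + w0).
Proof.
have [w0 w0P] : exists w0, w0 \notin artin_schreier @: F.
  apply/existsP; rewrite -negb_forall; apply/negP=> /forallP allF.
  have := card_artin_schreier_image; rewrite (eq_card (B := F)) => [|z].
    have: (0 < #|F|)%N by apply/card_gt0P; exists 0.
    by move=> F0 /eqP; rewrite -[X in _ == X]muln1 eqn_pmul2l.
  by rewrite allF.
exists w0 => [|w].
  apply: contraNneq w0P => ->; apply/imsetP; exists 0 => //.
  by rewrite /artin_schreier expr0n addr0.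
have [/imsetP[z _ ->]|wP] := boolP (w \in artin_schreier @: F).
  by left; exists z.
right; set S := artin_schreier @: F in w0P wP *.
have disjS : [disjoint S & [set z + w0 | z in S]].
  apply/pred0P=> y /=; apply/andP=> -[/imsetP[z _ ->]].
  case/imsetP=> _ /imsetP[u _ ->] eq_zu; case/imsetP: w0P; exists (z + u) => //.
  apply: (lincomb_eq char2 (lincomb1 char2 1 eq_zu)).
  by rewrite artin_schreierD; ring2 char2.
have : w \in S :|: [set z + w0 | z in S].
  suff -> : S :|: [set z + w0 | z in S] = setT by rewrite inE.
  apply/eqP; rewrite eqEcard subsetT cardsT /= cardsU disjoint_setI0 // cards0.
  rewrite (card_imset _ (@addIr F w0)).
  by rewrite subn0 addnn -muln2 card_artin_schreier_image.
rewrite inE (negPf wP) => /imsetP[_ /imsetP[z _ ->] ->]; exists z.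
ring2 char2.
Qed.

End Field2.

(** * Matrices of determinant one in characteristic two *)

Section SL2.

Variable F : finFieldType.
Hypothesis char2 : 2%N \in [pchar F].
Implicit Types (u w : {'GL_2[F]}) (v : F * F).

Definition mxa u : F := GLval u ord0 ord0.
Definition mxb u : F := GLval u ord0 (lift ord0 ord0).
Definition mxc u : F := GLval u (lift ord0 ord0) ord0.
Definition mxd u : F := GLval u (lift ord0 ord0) (lift ord0 ord0).
Definition mxtr u : F := mxa u + mxd u.

Lemma mxME u w :
  ((mxa (u * w)%g = mxa u * mxa w + mxb u * mxc w) *
   (mxb (u * w)%g = mxa u * mxb w + mxb u * mxd w) *
   (mxc (u * w)%g = mxc u * mxa w + mxd u * mxc w) *
   (mxd (u * w)%g = mxc u * mxb w + mxd u * mxd w)).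
Proof.
rewrite /mxa /mxb /mxc /mxd GL_MxE !mxE.
by rewrite !big_ord_recl !big_ord0 !addr0; do !split.
Qed.

Lemma mx1E : ((mxa 1%g = 1) * (mxb 1%g = 0) * (mxc 1%g = 0) * (mxd 1%g = 1)).
Proof. by rewrite /mxa /mxb /mxc /mxd GL_1E !mxE. Qed.

Lemma mx_eq u w :
  mxa u = mxa w -> mxb u = mxb w -> mxc u = mxc w -> mxd u = mxd w -> u = w.
Proof.
have ord2 (i : 'I_2) : i = ord0 \/ i = lift ord0 ord0.
  by case: i => -[|[|//]] ?; [left | right]; apply: val_inj.
move=> eqa eqb eqc eqd; apply: val_inj; apply/matrixP=> i j.
by case: (ord2 i) => ->; case: (ord2 j) => ->.
Qed.

Lemma SL2_det u : u \in SL 2 F -> mxa u * mxd u + mxb u * mxc u = 1.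
Proof.
rewrite inE (expand_det_row _ ord0) !big_ord_recl big_ord0 /cofactor !det_mx11.
move/eqP <-; rewrite !mxE /= addr0 mul1r mulN1r mulrN (oppr_pchar2 char2).
have -> : lift (lift ord0 ord0) 0 = ord0 :> 'I_2 by apply: val_inj.
by [].
Qed.

Lemma SL2_exists a b c d : a * d + b * c = 1 -> exists2 u,
  u \in SL 2 F & [/\ mxa u = a, mxb u = b, mxc u = c & mxd u = d].
Proof.
move=> det1.
pose M : 'M[F]_2 := \matrix_(i, j) if i == ord0 then if j == ord0 then a else b
                                   else if j == ord0 then c else d.
have detM : \det M = 1.
  rewrite (expand_det_row _ ord0) !big_ord_recl big_ord0 /cofactor !det_mx11.
  rewrite !mxE /= addr0 mul1r mulN1r mulrN (oppr_pchar2 char2).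
  by [].
have uM : M \in unitmx by rewrite unitmxE detM unitr1.
exists (Sub M uM : {'GL_2[F]}).
  by rewrite inE /GLval /= detM.
by split; rewrite /mxa /mxb /mxc /mxd /= mxE.
Qed.

(** By the Cayley-Hamilton theorem, u ^ 2 = tr(u) u - det(u). *)
Lemma SL2_involution u : u \in SL 2 F -> mxtr u = 0 -> (u ^+ 2 = 1)%g.
Proof.
move=> /SL2_det det1 /(sum0_eq char2) eq_ad; rewrite expgS expg1.
apply: mx_eq; rewrite !mxME !mx1E.
- apply: (lincomb_eq char2 (lincomb1 char2 1 det1)).
  by rewrite eq_ad; ring2 char2.
- by rewrite eq_ad; ring2 char2.
- by rewrite eq_ad; ring2 char2.
apply: (lincomb_eq char2 (lincomb1 char2 1 det1)).
by rewrite eq_ad; ring2 char2.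
Qed.

(** Modulo scalar matrices, u is determined by the vector of its trace, b and c,
    as a + d is the difference of the diagonal entries; u and w commute if and
    only if their vectors are proportional. *)
Lemma mx_commute u w :
    mxtr u * mxb w = mxtr w * mxb u -> mxtr u * mxc w = mxtr w * mxc u ->
  mxb u * mxc w = mxb w * mxc u -> commute u w.
Proof.
rewrite /mxtr => eq1 eq2 eq3.
apply: mx_eq; rewrite !mxME.
- by apply: (lincomb_eq char2 (lincomb1 char2 1 eq3)); ring2 char2.
- by apply: (lincomb_eq char2 (lincomb1 char2 1 eq1)); ring2 char2.
- by apply: (lincomb_eq char2 (lincomb1 char2 1 eq2)); ring2 char2.
- by apply: (lincomb_eq char2 (lincomb1 char2 1 eq3)); ring2 char2.
Qed.

Lemma commute_mx u w : commute u w ->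
  [/\ mxtr u * mxb w = mxtr w * mxb u, mxtr u * mxc w = mxtr w * mxc u
    & mxb u * mxc w = mxb w * mxc u].
Proof.
move=> cuw; have := congr1 mxa cuw; have := congr1 mxb cuw.
have := congr1 mxc cuw; rewrite !mxME /mxtr => eqc eqb eqa; split.
- by apply: (lincomb_eq char2 (lincomb1 char2 1 eqb)); ring2 char2.
- by apply: (lincomb_eq char2 (lincomb1 char2 1 eqc)); ring2 char2.
- by apply: (lincomb_eq char2 (lincomb1 char2 1 eqa)); ring2 char2.
Qed.

(** The form is the determinant of the rows v and v u, so for a nonzero row v
    it vanishes exactly when v spans an eigenline of u. *)
Definition fixes u v :=
  mxc u * v.2 ^+ 2 + mxtr u * (v.1 * v.2) + mxb u * v.1 ^+ 2 == 0.

(** ** Borel subgroups *)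

Section Borel.

Variable v : F * F.
Hypothesis nz_v : v != (0, 0).

Lemma vec_eq0 z : v.1 * z = 0 -> v.2 * z = 0 -> z = 0.
Proof.
move=> /eqP; rewrite mulf_eq0 => /orP[/eqP v1|/eqP->//] /eqP.
rewrite mulf_eq0 => /orP[/eqP v2|/eqP->//].
by case/eqP: nz_v; rewrite [v]surjective_pairing v1 v2.
Qed.

Definition scales u z :=
  (v.1 * mxa u + v.2 * mxc u == z * v.1) &&
  (v.1 * mxb u + v.2 * mxd u == z * v.2).

Lemma fixesP u : reflect (exists z, scales u z) (fixes u v).
Proof.
apply: (iffP eqP) => [|[z /andP[/eqP e1 /eqP e2]]]; last first.
  apply: (lincomb_eq char2 (lincombD (lincomb1 char2 v.2 e1)
                                      (lincomb1 char2 v.1 e2))).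
  by rewrite /mxtr; ring2 char2.
rewrite /mxtr => fix_v.
have [v1|v1] := eqVneq v.1 0; last first.
  exists ((v.1 * mxa u + v.2 * mxc u) / v.1); rewrite /scales divfK // eqxx /=.
  apply/eqP; apply: (mulfI v1).
  rewrite mulrA [v.1 * (_ / _)]mulrC divfK //.
  by apply: (lincomb_eq char2 (lincomb1 char2 1 fix_v)); ring2 char2.
exists (mxd u).
rewrite /scales v1 !mul0r !add0r [_ * mxd u]mulrC eqxx andbT mulr0.
rewrite v1 mul0r mulr0 addr0 expr0n mulr0 addr0 in fix_v.
by move/eqP: fix_v; rewrite mulf_eq0 expf_eq0 /= mulf_eq0 orbC.
Qed.

Lemma scalesM u w y z : scales u y -> scales w z -> scales (u * w)%g (y * z).
Proof.
move=> /andP[/eqP u1 /eqP u2] /andP[/eqP w1 /eqP w2].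
rewrite /scales !mxME; apply/andP; split; apply/eqP.
  apply: (lincomb_eq char2 (lincombD (lincomb1 char2 y w1)
    (lincombD (lincomb1 char2 (mxa w) u1) (lincomb1 char2 (mxc w) u2)))).
  ring2 char2.
apply: (lincomb_eq char2 (lincombD (lincomb1 char2 y w2)
  (lincombD (lincomb1 char2 (mxb w) u1) (lincomb1 char2 (mxd w) u2)))).
ring2 char2.
Qed.

Lemma scales1 : scales 1%g 1.
Proof. by rewrite /scales !mx1E !mulr1 !mulr0 addr0 add0r !mul1r !eqxx. Qed.

Lemma scales_neq0 u z : u \in SL 2 F -> scales u z -> z != 0.
Proof.
move=> /SL2_det det1 /andP[/eqP u1 /eqP u2]; apply/eqP=> z0.
suff : 1 = 0 :> F by apply/eqP; rewrite oner_eq0.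
rewrite -det1; rewrite z0 !mul0r in u1 u2; apply: vec_eq0.
  apply: (lincomb_eq char2 (lincombD (lincomb1 char2 (mxd u) u1)
                                      (lincomb1 char2 (mxc u) u2))).
  ring2 char2.
apply: (lincomb_eq char2 (lincombD (lincomb1 char2 (mxb u) u1)
                                      (lincomb1 char2 (mxa u) u2))).
ring2 char2.
Qed.

Definition borel := [set u in SL 2 F | fixes u v].
Definition unipotent := [set u in SL 2 F | scales u 1].

Lemma in_borel u : (u \in borel) = (u \in SL 2 F) && fixes u v.
Proof. by rewrite in_set. Qed.

Lemma in_unipotent u : (u \in unipotent) = (u \in SL 2 F) && scales u 1.
Proof. by rewrite in_set. Qed.

Lemma borel_group_set : group_set borel.
Proof.
apply/group_setP; split=> [|u w].
  by rewrite in_borel group1; apply/fixesP; exists 1; apply: scales1.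
rewrite !in_borel => /andP[SLu /fixesP[y fu]] /andP[SLw /fixesP[z fw]].
by rewrite groupM //; apply/fixesP; exists (y * z); apply: scalesM.
Qed.
Canonical borel_group := Group borel_group_set.

Lemma unipotent_group_set : group_set unipotent.
Proof.
apply/group_setP; split=> [|u w].
  by rewrite in_unipotent group1 scales1.
rewrite !in_unipotent => /andP[SLu fu] /andP[SLw fw].
by rewrite groupM //= -[1]mul1r scalesM.
Qed.
Canonical unipotent_group := Group unipotent_group_set.

(** The eigenvalue on v is a character of the Borel subgroup, so it is trivial
    on commutators. *)
Lemma borel_der1 : borel^`(1)%g \subset unipotent.
Proof.
rewrite gen_subG; apply/subsetP=> _ /imset2P[x y Bx By ->].
move: Bx By; rewrite !in_borel in_unipotent.
move=> /andP[SLx /fixesP[a fx]] /andP[SLy /fixesP[b fy]].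
rewrite groupR //=; have fxy := scalesM fx fy; have fyx := scalesM fy fx.
have ba0 := scales_neq0 (groupM SLy SLx) fyx.
move: fxy; rewrite commgC /scales !(mxME (y * x)%g); set g := [~ x, y].
case/andP: fyx => /eqP f1 /eqP f2 /andP[/eqP f3 /eqP f4].
apply/andP; split; apply/eqP; apply: (mulfI ba0).
  apply: (lincomb_eq char2 (lincombD (lincomb1 char2 1 f3)
    (lincombD (lincomb1 char2 (mxa g) f1) (lincomb1 char2 (mxc g) f2)))).
  ring2 char2.
apply: (lincomb_eq char2 (lincombD (lincomb1 char2 1 f4)
  (lincombD (lincomb1 char2 (mxb g) f1) (lincomb1 char2 (mxd g) f2)))).
ring2 char2.
Qed.

(** An element u of determinant 1 that fixes the row v has trace 0 because
    det(u - 1) = 0, and then the equation [fixes u v] forces its entries b and c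
    into a ratio that depends only on v. *)
Lemma unipotent_abelian : abelian unipotent.
Proof.
have U0 u : u \in unipotent ->
    mxtr u = 0 /\ mxc u * v.2 ^+ 2 = mxb u * v.1 ^+ 2.
  rewrite in_unipotent => /andP[/SL2_det det1 /andP[/eqP f1 /eqP f2]].
  have tr0 : mxtr u = 0.
    apply: vec_eq0.
      apply: (lincomb_eq char2 (lincombD (lincomb1 char2 v.1 det1)
        (lincombD (lincomb1 char2 (1 + mxd u) f1)
                  (lincomb1 char2 (mxc u) f2)))).
      by rewrite /mxtr; ring2 char2.
    apply: (lincomb_eq char2 (lincombD (lincomb1 char2 v.2 det1)
      (lincombD (lincomb1 char2 (mxb u) f1) (lincomb1 char2 (1 + mxa u) f2)))).
    by rewrite /mxtr; ring2 char2.
  split=> //.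
  apply: (lincomb_eq char2 (lincombD (lincomb1 char2 (v.1 * v.2) tr0)
    (lincombD (lincomb1 char2 v.2 f1) (lincomb1 char2 v.1 f2)))).
  by rewrite /mxtr; ring2 char2.
apply/centsP=> x /U0[trx fx] y /U0[try fy].
apply: mx_commute; rewrite ?trx ?try ?mul0r //.
have root (z t : F) : z ^+ 2 * t = 0 -> z * t = 0.
  move/eqP; rewrite mulf_eq0 expf_eq0 /= => zt0.
  by apply/eqP; rewrite mulf_eq0.
apply: (sum0_eq char2); apply: vec_eq0; apply: root.
  apply: (lincomb_eq char2 (lincombD (lincomb1 char2 (mxc y) fx)
                                      (lincomb1 char2 (mxc x) fy))).
  ring2 char2.
apply: (lincomb_eq char2 (lincombD (lincomb1 char2 (mxb y) fx)
                                    (lincomb1 char2 (mxb x) fy))).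
ring2 char2.
Qed.

Lemma borel_solvable : solvable borel.
Proof.
rewrite (series_sol (der_normal 1 borel_group)).
rewrite (solvableS borel_der1) ?abelian_sol ?unipotent_abelian //=.
exact: (der_abelian 0).
Qed.

End Borel.

Lemma solvable_fixes u w v : v != (0, 0) ->
    u \in SL 2 F -> w \in SL 2 F -> fixes u v -> fixes w v ->
  solvable <<[set u; w]>>.
Proof.
move=> nz_v SLu SLw fu fw; apply: solvableS (borel_solvable nz_v).
rewrite /= (gen_subG _ (borel_group v)) subUset !sub1set !in_borel.
by rewrite SLu SLw fu.
Qed.

End SL2.

Arguments fixes {F} u v.

(** * Soluble normal subgroups *)

Section Radical.

Variables (F : finFieldType) (q : F).
Hypothesis char2 : 2%N \in [pchar F].
Hypotheses (q0 : q != 0) (q1 : q != 1).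
Implicit Types (u w : {'GL_2[F]}).

Lemma SL2_involutionV u : u \in SL 2 F -> mxtr u = 0 -> (u^-1 = u)%g.
Proof.
move=> SLu /(SL2_involution char2 SLu) u2.
by apply/eqP; rewrite eq_invg_mul -[X in _ == X]u2.
Qed.

(** An element x of an abelian normal subgroup commutes with its conjugates by
    the transvections with b = t. Such a conjugation leaves c and the trace
    alone and changes b by t (tr(x) + t c), so commuting is a polynomial
    condition on t; it holds for t = 1 and for t = q with q different from 0
    and 1, which forces tr(x) = c = 0. Exchanging the basis vectors
    gives b = 0 as well. *)
Lemma SL2_abelian_normal (N : {group {'GL_2[F]}}) :
  N <| SL 2 F -> abelian N -> N :=: 1%g.
Proof.
move=> /andP[/subsetP sNS nNS] abN.
have lower x : x \in N -> mxtr x = 0 /\ mxc x = 0.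
  move=> Nx.
  have transvect t : mxc x * (t * (mxtr x + t * mxc x)) = 0 /\
                     mxtr x * (t * (mxtr x + t * mxc x)) = 0.
    have [|g SLg [ga gb gc gd]] := @SL2_exists _ char2 1 t 0 1.
      by rewrite mulr0 addr0 mulr1.
    have gV : (g^-1 = g)%g.
      by apply: SL2_involutionV => //; rewrite /mxtr ga gd (addrr_pchar2 char2).
    have Nxg : (x ^ g)%g \in N by rewrite memJ_norm // (subsetP nNS).
    have [] := commute_mx char2 (centsP abN _ Nx _ Nxg).
    rewrite conjgE gV /mxtr !mxME ga gb gc gd => e1 _ e3; split.
      by apply: (lincomb_eq char2 (lincomb1 char2 1 e3)); ring2 char2.
    by apply: (lincomb_eq char2 (lincomb1 char2 1 e1)); ring2 char2.
  have c0 : mxc x = 0.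
    apply/eqP; apply: contraT => c0; case/eqP: q1.
    have tr_c t : t != 0 -> mxtr x = t * mxc x.
      move=> t0; have [/eqP + _] := transvect t.
      rewrite !mulf_eq0 (negPf c0) (negPf t0) /=.
      by move=> /eqP/(sum0_eq char2).
    by apply: (mulIf c0); rewrite -tr_c // -tr_c ?oner_neq0.
  split=> //; have [_ /eqP] := transvect 1.
  by rewrite c0 mulr0 addr0 mul1r mulf_eq0 orbb => /eqP.
apply/trivgP/subsetP=> x Nx; rewrite inE; apply/eqP.
have [trx cx] := lower x Nx.
(* Conjugation by g exchanges b and c. *)
have [|g SLg [ga _ gc gd]] := @SL2_exists _ char2 0 1 1 0.
  by rewrite mulr0 add0r mulr1.
have gV : (g^-1 = g)%g.
  by apply: SL2_involutionV => //; rewrite /mxtr ga gd addr0.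
have [|_] := lower (x ^ g)%g; first by rewrite memJ_norm // (subsetP nNS).
rewrite conjgE gV !mxME ga gc gd.
rewrite !(mul0r, mulr0, mul1r, mulr1, addr0, add0r) => bx.
have ad : mxa x = mxd x by apply: (sum0_eq char2).
have a1 : mxa x = 1.
  apply: (sum0_eq char2); apply/eqP; rewrite -sqrf_eq0; apply/eqP.
  apply: (lincomb_eq char2 (lincomb1 char2 1 (SL2_det char2 (sNS x Nx)))).
  by rewrite cx -ad; ring2 char2.
by apply: mx_eq; rewrite !mx1E // -ad.
Qed.

(** The last nontrivial term of the derived series is abelian and
    characteristic. *)
Lemma SL2_solvable_normal (N : {group {'GL_2[F]}}) :
  N <| SL 2 F -> solvable N -> N :=: 1%g.
Proof.
move=> nsN /derivedP[n]; elim: n => [|n IHn] //= Nn.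
apply: IHn; apply: SL2_abelian_normal.
  exact: char_normal_trans (der_char n N) nsN.
by apply/commG1P.
Qed.

End Radical.

(** * Split elements *)

Section Split.

Variables (F : finFieldType) (q : F).
Hypothesis char2 : 2%N \in [pchar F].
Hypotheses (q0 : q != 0) (q1 : q != 1).
Implicit Types (u x y : {'GL_2[F]}) (v w : F * F) (A : {set F * F}).

(** One representative of each line of F ^ 2, so that distinct points are
    linearly independent and can be compared by equality. *)
Definition points : {set F * F} := [set v | (v.1 == 1) || (v == (0, 1))].
Definition wedge v w : F := v.1 * w.2 + v.2 * w.1.

Lemma points_wedge v w :
  v \in points -> w \in points -> v != w -> wedge v w != 0.
Proof.
case: v w => [v1 v2] [w1 w2]; rewrite !inE /wedge /= !xpair_eqE.
move=> /orP[/eqP->|/andP[/eqP-> /eqP->]] /orP[/eqP->|/andP[/eqP-> /eqP->]];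
  rewrite ?eqxx /= ?(mul1r, mulr1, mul0r, mulr0, addr0, add0r) ?oner_eq0 //.
by move=> neq_vw; apply: contra neq_vw => /eqP /(sum0_eq char2) ->.
Qed.

Lemma points_neq0 v : v \in points -> v != (0, 0).
Proof.
by rewrite inE => /orP[/eqP v1|/eqP->]; rewrite ?xpair_eqE ?oner_eq0 ?andbF //;
  apply: contra_eq_neq v1 => ->; rewrite /= eq_sym oner_neq0.
Qed.

Definition split_over A := [set u in SL 2 F | (mxtr u != 0) &&
  [exists v in A, exists w in A, [&& v != w, fixes u v & fixes u w]]].

Lemma splitP A u : reflect
  [/\ u \in SL 2 F, mxtr u != 0 & exists v w,
    [/\ v \in A, w \in A, v != w, fixes u v & fixes u w]]
  (u \in split_over A).
Proof.
rewrite [u \in split_over A]in_set.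
apply: (iffP andP) => [[SLu /andP[tru fixu]]|[SLu tru fixu]]; split=> //.
  have [v vA /exists_inP[w wA /and3P[]]] := exists_inP fixu.
  by exists v, w.
have [v [w [vA wA neq_vw fv fw]]] := fixu; rewrite tru.
apply/exists_inP; exists v => //.
by apply/exists_inP; exists w => //; apply/and3P.
Qed.

(** The witness acts on the rows v and w as multiplication by z and 1 / z. Its
    entry a, multiplied by the determinant of v and w, is recorded to tell
    elements with different z apart. *)
Lemma split_exists v w z : wedge v w != 0 -> z != 0 -> z != 1 ->
  exists u, [/\ u \in SL 2 F, mxtr u != 0, fixes u v, fixes u w &
                mxa u * wedge v w = z * (v.1 * w.2) + z^-1 * (v.2 * w.1)].
Proof.
move=> nz_vw z0 z1.
have := mulfV z0; have := mulfV nz_vw; move: (z^-1) ((wedge v w)^-1) => z' e.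
rewrite /wedge => eD zz.
have [|u SLu [ua ub uc ud]] := @SL2_exists _ char2
    (e * (z * (v.1 * w.2) + z' * (v.2 * w.1))) (e * ((z + z') * (v.2 * w.2)))
    (e * ((z + z') * (v.1 * w.1))) (e * (z * (v.2 * w.1) + z' * (v.1 * w.2))).
  set D := _ + _ in eD.
  have De : D ^+ 2 * e ^+ 2 = 1 by rewrite -exprMn eD expr1n.
  apply: (lincomb_eq char2 (lincombD (lincomb1 char2 1 De)
                                     (lincomb1 char2 (D ^+ 2 * e ^+ 2) zz))).
  by rewrite /D; ring2 char2.
have tru : mxtr u = z + z'.
  rewrite /mxtr ua ud.
  by apply: (lincomb_eq char2 (lincomb1 char2 (z + z') eD)); ring2 char2.
exists u; split=> //.
- rewrite tru; apply: contra z1 => /eqP/(sum0_eq char2) eq_zz.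
  apply/eqP/(sum0_eq char2)/eqP; rewrite -sqrf_eq0; apply/eqP.
  apply: (lincomb_eq char2 (lincombD (lincomb1 char2 1 zz)
                                      (lincomb1 char2 z eq_zz))).
  ring2 char2.
- apply/eqP; rewrite tru ub uc.
  apply: (lincomb_eq char2 (lincomb1 char2 ((z + z') * (v.1 * v.2)) eD)).
  ring2 char2.
- apply/eqP; rewrite tru ub uc.
  apply: (lincomb_eq char2 (lincomb1 char2 ((z + z') * (w.1 * w.2)) eD)).
  ring2 char2.
rewrite ua.
set c := z * (v.1 * w.2) + z' * (v.2 * w.1).
apply: (lincomb_eq char2 (lincomb1 char2 c eD)).
ring2 char2.
Qed.

(** A nonzero binary quadratic form does not vanish on three lines; the trace is
    isolated by the cofactors of a Vandermonde matrix, which are squares in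
    characteristic two. *)
Lemma fixes3_trace0 u v w (t : F * F) :
    wedge v w != 0 -> wedge w t != 0 -> wedge v t != 0 ->
  fixes u v -> fixes u w -> fixes u t -> mxtr u = 0.
Proof.
move=> vw wt vt /eqP fv /eqP fw /eqP ft.
apply: (mulfI vw); apply: (mulfI wt); apply: (mulfI vt); rewrite !mulr0.
apply: (lincomb_eq char2 (lincombD (lincomb1 char2 (wedge w t ^+ 2) fv)
  (lincombD (lincomb1 char2 (wedge v t ^+ 2) fw)
            (lincomb1 char2 (wedge v w ^+ 2) ft)))).
rewrite /wedge; ring2 char2.
Qed.

Lemma soladj_fixes v x y : v \in points -> x \in SL 2 F -> y \in SL 2 F ->
  fixes x v -> fixes y v -> x != y -> soladj x y.
Proof.
move=> /points_neq0 v0 SLx SLy fx fy neq_xy.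
by rewrite /soladj neq_xy (solvable_fixes char2 v0).
Qed.

(** By induction on A: the split elements over A that fix a form a clique, which
    is traversed so as to end with an element fixing a and some c other than
    a and b; a path for the remaining points, starting at c, comes next. *)
Lemma split_ham_path A a b :
    A \subset points -> a \in A -> b \in A -> a != b ->
  ham_path soladj (split_over A) (fixes^~ a) (fixes^~ b).
Proof.
have [n] := ubnP #|A|; elim: n A a => // n IHn A a /ltnSE leAn.
move=> /subsetP sAP aA bA neq_ab.
have wedgeA v w : v \in A -> w \in A -> v != w -> wedge v w != 0.
  by move=> /sAP vP /sAP; apply: points_wedge.
have cliqueA (W : {set {'GL_2[F]}}) :
    {in W, forall u, u \in SL 2 F /\ fixes u a} ->
    {in W &, forall x y, x != y -> soladj x y}.
  move=> fixW u w /fixW[SLu fu] /fixW[SLw fw].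
  exact: (soladj_fixes (sAP a aA)).
have split_trace u : u \in split_over A -> mxtr u != 0 by case/splitP.
have wedge_ab := wedgeA a b aA bA neq_ab.
have [b1 [SLb1 trb1 ab1 bb1 eq_b1]] := split_exists wedge_ab q0 q1.
have b1A : b1 \in split_over A by apply/splitP; split=> //; exists a, b.
(* If a and b are the only points, the set is a clique and the two end points
   are elements with eigenvalues q and 1 / q on a. *)
have [/exists_inP[c cA /andP[neq_ca neq_cb]]|/exists_inPn noc] :=
    boolP [exists c in A, (c != a) && (c != b)]; last first.
  have only_ab c : c \in A -> c != a -> c = b.
    by move=> cA neq_ca; apply/eqP; have := noc c cA; rewrite neq_ca negbK.
  have fix_ab u : u \in split_over A ->
      [/\ u \in SL 2 F, fixes u a & fixes u b].
    case/splitP=> SLu _ [v [w [vA wA neq_vw fv fw]]].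
    have [eq_va|neq_va] := eqVneq v a.
      have <- : w = b by apply: only_ab; rewrite // -eq_va eq_sym.
      by rewrite -eq_va.
    have eq_vb := only_ab v vA neq_va; rewrite -eq_vb.
    have [<-//|neq_wa] := eqVneq w a.
    by case/eqP: neq_vw; rewrite eq_vb (only_ab w).
  have qV0 : q^-1 != 0 by rewrite invr_eq0.
  have qV1 : q^-1 != 1 by rewrite -[1]invr1 (inj_eq invr_inj).
  have [b2 [SLb2 trb2 ab2 bb2 eq_b2]] := split_exists wedge_ab qV0 qV1.
  have b2A : b2 \in split_over A by apply/splitP; split=> //; exists a, b.
  have neq_b : b1 != b2.
    apply/eqP=> eq_b; case/eqP: wedge_ab.
    have qV : q * q^-1 = 1 by rewrite mulfV.
    move: eq_b2; rewrite invrK -eq_b eq_b1 => e.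
    have : (q + 1) ^+ 2 * wedge a b = 0.
      apply: (lincomb_eq char2 (lincombD (lincomb1 char2 q e)
        (lincomb1 char2 (wedge a b) qV))).
      by rewrite /wedge; ring2 char2.
    move/eqP; rewrite mulf_eq0 sqrf_eq0.
    case/orP=> [/eqP/(sum0_eq char2)/eqP|/eqP//].
    by rewrite (negPf q1).
  have cliqueS : {in split_over A &, forall x y, x != y -> soladj x y}.
    by apply: cliqueA => u /fix_ab[].
  apply: ham_path_weaken (clique_ham_path b1A b2A neq_b cliqueS).
    by move=> _ _ /eqP->.
  by move=> _ _ /eqP->.
have neq_ac : a != c by rewrite eq_sym.
have [c1 [SLc1 trc1 ac1 cc1 _]] := split_exists (wedgeA a c aA cA neq_ac) q0 q1.
(* This keeps the element c1, which fixes a and c, apart from the elements that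
   fix two points other than a. *)
have not_3 u v w : u \in SL 2 F -> mxtr u != 0 -> v \in A -> w \in A ->
    v != w -> v != a -> w != a -> fixes u v -> fixes u w -> fixes u a -> False.
  move=> SLu tru vA wA neq_vw neq_va neq_wa fv fw fa; case/eqP: tru.
  exact: (fixes3_trace0 (wedgeA _ _ vA wA neq_vw) (wedgeA _ _ wA aA neq_wa)
                        (wedgeA _ _ vA aA neq_va)).
have splitA' u : u \in split_over (A :\ a) -> ~~ fixes u a.
  case/splitP=> SLu tru [v [w [vA' wA' neq fv fw]]].
  have [[neq_va vA] [neq_wa wA]] := (setD1P vA', setD1P wA').
  by apply/negP=> /(not_3 u v w); apply.
have subA' : split_over (A :\ a) \subset split_over A.
  apply/subsetP=> u /splitP[SLu tru [v [w [vA' wA' neq fv fw]]]].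
  have [[_ vA] [_ wA]] := (setD1P vA', setD1P wA').
  by apply/splitP; split=> //; exists v, w.
pose B := split_over A :\: split_over (A :\ a).
have inB u : u \in SL 2 F -> mxtr u != 0 -> fixes u a ->
    (exists v, [/\ v \in A, v != a & fixes u v]) -> u \in B.
  move=> SLu tru fa [v [vA neq_va fv]]; rewrite inE; apply/andP; split.
    by apply: contraL fa; apply: splitA'.
  by apply/splitP; split=> //; exists v, a.
have Ba u : u \in B -> u \in SL 2 F /\ fixes u a.
  case/setDP=> /splitP[SLu tru [v [w [vA wA neq_vw fv fw]]]] nB; split=> //.
  have [<-//|neq_va] := eqVneq v a; have [<-//|neq_wa] := eqVneq w a.
  case/splitP: nB; split=> //; exists v, w; split=> //; exact/setD1P.
have neq_ba : b != a by rewrite eq_sym.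
have b1B : b1 \in B by apply: inB => //; exists b.
have c1B : c1 \in B by apply: inB => //; exists c.
have neq_bc : b1 != c1.
  apply/eqP=> eq_bc; rewrite -eq_bc in cc1.
  by apply: (not_3 b1 b c) => //; rewrite eq_sym.
have -> : split_over A = B :|: split_over (A :\ a).
  by rewrite -[LHS](setID _ (split_over (A :\ a))) (setIidPr subA') setUC.
apply: (ham_path_cat (Q1 := pred1 c1) (P2 := fixes^~ c)).
- apply: ham_path_weaken (clique_ham_path b1B c1B neq_bc (cliqueA _ Ba)) => //.
  by move=> _ _ /eqP->.
- apply: IHn => //.
  + by apply: leq_trans leAn; rewrite [#|A|](cardsD1 a) aA.
  + by apply/subsetP=> v /setD1P[_ /sAP].
  + exact/setD1P.
  + exact/setD1P.
- rewrite disjoint_sym disjoints_subset.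
  by apply/subsetP=> u uA'; rewrite in_setC in_setD uA'.
- move=> x y xB yA' /eqP eq_x fy; rewrite {x xB}eq_x.
  apply: (soladj_fixes (sAP c cA)) => //.
    by case/splitP: yA'.
  by apply: contraTneq ac1 => ->; apply: splitA'.
Qed.

End Split.

(** * Nonsplit elements and the involutions inverting them *)

Section Nonsplit.

Variables (F : finFieldType) (w0 : F).
Hypothesis char2 : 2%N \in [pchar F].
Hypothesis w0_neq0 : w0 != 0.
Hypothesis w0_coset : forall w, (exists z, artin_schreier z = w) \/
                               (exists z, artin_schreier z = w + w0).
Implicit Types (s u x y : {'GL_2[F]}).

Definition nonsplit : {set {'GL_2[F]}} :=
  [set x in SL 2 F | (mxtr x != 0) && (x \notin split_over (points F))].

(** These are the involutions that do not fix the point (1, 0); such an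
    involution is determined by its first row. *)
Definition flips : {set {'GL_2[F]}} :=
  [set x in SL 2 F | (mxtr x == 0) && (mxb x != 0)].

Lemma nonsplitP x : reflect
  [/\ x \in SL 2 F, mxtr x != 0 & x \notin split_over (points F)]
  (x \in nonsplit).
Proof.
rewrite [x \in nonsplit]in_set.
by apply: (iffP andP) => [[? /andP[]]|[? ? ?]]; split=> //; apply/andP.
Qed.

Lemma flipsP x : reflect
  [/\ x \in SL 2 F, mxtr x = 0 & mxb x != 0] (x \in flips).
Proof.
rewrite [x \in flips]in_set.
by apply: (iffP andP) => [[? /andP[/eqP]]|[? /eqP ? ?]]; split=> //; apply/andP.
Qed.

(** With delta = 1 / w0, two involutions have the same key exactly when they
    have the same b and their entries a are equal or differ by delta. For x of
    nonzero trace t, an involution s inverts x when tr(s x) = 0. This equation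
    for both (a, b) and (a + delta, b) amounts to b = delta * b(x) / t and
    a ^ 2 + delta * a = 1 + delta ^ 2 * b(x) * c(x) / t ^ 2, so the key of x is
    the key of the pair of involutions that invert it. *)
Definition key x : F * F :=
  if mxtr x == 0 then (mxb x, mxa x ^+ 2 + mxa x / w0)
  else (mxb x / mxtr x / w0, 1 + mxb x * mxc x / mxtr x ^+ 2 / w0 ^+ 2).

(** If c <> 0, the fixed points (1, u) of x are the roots of
    c u ^ 2 + t u + b, with t the trace of x; the substitution u = t z / c
    turns this equation into z ^ 2 + z = b c / t ^ 2, whose solutions
    come in pairs z, z + 1. *)
Lemma nonsplit_no_root x z : x \in nonsplit ->
  artin_schreier z <> mxb x * mxc x / mxtr x ^+ 2.
Proof.
case/nonsplitP=> SLx trx /negP nsplit eq_z; apply: nsplit.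
have eq_z' : (z * mxtr x) ^+ 2 + z * mxtr x * mxtr x = mxb x * mxc x.
  have t2 : mxtr x ^+ 2 != 0 by rewrite expf_eq0.
  by rewrite -(divfK t2 (mxb x * mxc x)) -eq_z /artin_schreier; ring.
have pt1 t : (1, t) \in points F by rewrite inE eqxx.
have fix1 t : mxc x * t ^+ 2 + mxtr x * t + mxb x = 0 -> fixes x (1, t).
  by rewrite /fixes /= expr1n mulr1 mul1r => ->.
apply/splitP; split=> //; have [c0|c0] := eqVneq (mxc x) 0.
  exists (0, 1), (1, mxb x / mxtr x); split=> //.
  - by rewrite inE eqxx orbT.
  - by rewrite xpair_eqE eq_sym oner_eq0.
  - by rewrite /fixes /= c0 !mul0r expr0n mulr0 !mulr0 !addr0.
  apply: fix1; rewrite c0 mul0r add0r mulrCA mulfV // mulr1.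
  by rewrite (addrr_pchar2 char2).
have fix_div t : t ^+ 2 + t * mxtr x = mxb x * mxc x -> fixes x (1, t / mxc x).
  move=> eq_t; apply: fix1; apply: (mulfI c0).
  have -> : mxc x * (mxc x * (t / mxc x) ^+ 2 + mxtr x * (t / mxc x) + mxb x) =
            t ^+ 2 + t * mxtr x + mxb x * mxc x by field.
  by rewrite eq_t (addrr_pchar2 char2) mulr0.
exists (1, z * mxtr x / mxc x), (1, (z * mxtr x + mxtr x) / mxc x); split=> //.
- rewrite xpair_eqE eqxx /=; apply: contra trx => /eqP/(mulIf _) eq_z1.
  apply/eqP; apply: (addrI (z * mxtr x)); rewrite addr0 -eq_z1 //.
  by rewrite invr_eq0.
- exact: fix_div.
- apply: fix_div; apply: (lincomb_eq char2 (lincomb1 char2 1 eq_z')).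
  ring2 char2.
Qed.

Lemma nonsplit_b x : x \in nonsplit -> mxb x != 0.
Proof.
move=> /(@nonsplit_no_root x 0) as0; apply/eqP=> b0; apply: as0.
by rewrite b0 !mul0r /artin_schreier expr0n addr0.
Qed.

Lemma flip_exists a b : b != 0 ->
  exists s, [/\ s \in flips, mxa s = a & mxb s = b].
Proof.
move=> b0; have [|s SLs [sa sb _ sd]] :=
    @SL2_exists _ char2 a b ((a ^+ 2 + 1) / b) a.
  by rewrite mulrC [b * _]mulrC divfK //; ring2 char2.
exists s; split=> //; apply/flipsP; split=> //; last by rewrite sb.
by rewrite /mxtr sa sd (addrr_pchar2 char2).
Qed.

Lemma key_flip s : s \in flips -> key s = (mxb s, mxa s ^+ 2 + mxa s / w0).
Proof. by case/flipsP=> _ trs _; rewrite /key trs eqxx. Qed.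

Lemma key_nonsplit x : x \in nonsplit ->
  key x = (mxb x / mxtr x / w0, 1 + mxb x * mxc x / mxtr x ^+ 2 / w0 ^+ 2).
Proof. by case/nonsplitP=> _ trx _; rewrite /key (negPf trx). Qed.

(** For a nonsplit x the equation for the entry a of the involution becomes, for
    a = 1 + z / w0, the equation z ^ 2 + z = b c / t ^ 2 + w0. It has a solution
    because b c / t ^ 2 is not in the image of the Artin-Schreier map. *)
Lemma key_has_flip x : x \in flips :|: nonsplit ->
  exists2 s, s \in flips & key s = key x.
Proof.
case/setUP=> [xI|xN]; first by exists x.
have trx : mxtr x != 0 by case/nonsplitP: xN.
have [[z eq_z]|[z eq_z]] := w0_coset (mxb x * mxc x / mxtr x ^+ 2).
  by case: (nonsplit_no_root xN eq_z).
have [|s [sI sa sb]] := @flip_exists (1 + z / w0) (mxb x / mxtr x / w0).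
  by rewrite !mulf_neq0 ?invr_eq0 ?nonsplit_b.
exists s => //; rewrite key_flip // key_nonsplit // sa sb; congr pair.
have -> : (1 + z / w0) ^+ 2 + (1 + z / w0) / w0 =
  1 + (artin_schreier z + w0) / w0 ^+ 2 + 2%:R * (z / w0).
  by rewrite /artin_schreier; field.
by rewrite (pcharf0 char2) mul0r addr0 eq_z -addrA (addrr_pchar2 char2) addr0.
Qed.

Lemma flip_partner s : s \in flips ->
  exists s', [/\ s' \in flips, s != s' & key s' = key s].
Proof.
move=> sI; have [_ _ b0] := flipsP _ sI.
have [s' [s'I s'a s'b]] := flip_exists (mxa s + w0^-1) b0.
exists s'; split=> //.
  apply/eqP=> eq_s; have /eqP : w0^-1 = 0.
    by apply: (addrI (mxa s)); rewrite addr0 -s'a -eq_s.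
  by rewrite invr_eq0 (negPf w0_neq0).
rewrite !key_flip // s'a s'b; congr pair.
have -> : (mxa s + w0^-1) ^+ 2 + (mxa s + w0^-1) / w0 =
  mxa s ^+ 2 + mxa s / w0 + 2%:R * (mxa s / w0 + w0^-1 ^+ 2) by ring.
by rewrite (pcharf0 char2) mul0r addr0.
Qed.

Lemma soladj_involutions s s' : s \in SL 2 F -> s' \in SL 2 F ->
  mxtr s = 0 -> mxtr s' = 0 -> s != s' -> soladj s s'.
Proof.
move=> SLs SLs' trs trs' neq_ss; rewrite /soladj neq_ss.
by apply: solvable_involutions; apply: (SL2_involution char2).
Qed.

(** Equal keys imply tr(s x) = 0, so s and s x are involutions. *)
Lemma soladj_flip_nonsplit s x : s \in flips -> x \in nonsplit ->
  key s = key x -> soladj s x.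
Proof.
move=> sI xN; rewrite key_flip // key_nonsplit // => -[eq_b eq_a].
have [SLs trs b0] := flipsP _ sI; have [SLx trx _] := nonsplitP _ xN.
rewrite /soladj; apply/andP; split.
  by apply: contraNneq trx => <-; rewrite trs.
apply: solvable_inverting; first exact: (SL2_involution char2).
apply: (SL2_involution char2); first exact: groupM.
have ds : mxa s = mxd s by apply: (sum0_eq char2).
have det := SL2_det char2 SLs; rewrite -ds in det.
have eq_bx : mxb x = mxb s * mxtr x * w0 by rewrite eq_b; field; apply/andP.
have eq_c : w0 * mxtr x * mxa s ^+ 2 + mxtr x * mxa s =
            w0 * mxtr x + mxb s * mxc x.
  have -> : w0 * mxtr x * mxa s ^+ 2 + mxtr x * mxa s =
            (mxa s ^+ 2 + mxa s / w0) * (w0 * mxtr x) by field.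
  by rewrite eq_a eq_bx; field; apply/andP.
(* The entry c of s is known only through the determinant, as (a ^ 2 + 1) / b;
   hence the multiplication by b. *)
apply: (mulfI b0); rewrite mulr0 [mxtr (s * x)%g]/mxtr !mxME -ds.
apply: (lincomb_eq char2 (lincombD (lincomb1 char2 (mxb x) det)
  (lincombD (lincomb1 char2 (mxa s ^+ 2 + 1) eq_bx)
            (lincomb1 char2 (mxb s) eq_c)))).
rewrite /mxtr; ring2 char2.
Qed.

(** The key determines b / t and c / t, hence the torus. *)
Lemma soladj_nonsplit x y : x \in nonsplit -> y \in nonsplit ->
  key x = key y -> x != y -> soladj x y.
Proof.
move=> xN yN; rewrite !key_nonsplit // => -[eq_b eq_c] neq_xy.
have [SLx trx _] := nonsplitP _ xN; have [SLy tr_y _] := nonsplitP _ yN.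
rewrite /soladj neq_xy; apply: solvable_commute.
have b0 := nonsplit_b yN.
have eq_b' : mxb x * mxtr y = mxb y * mxtr x.
  have -> : mxb x = mxb x / mxtr x / w0 * (mxtr x * w0) by field; apply/andP.
  by rewrite eq_b; field; apply/andP.
have eq_c' : mxb x * mxc x * mxtr y ^+ 2 = mxb y * mxc y * mxtr x ^+ 2.
  have -> : mxb x * mxc x =
      mxb x * mxc x / mxtr x ^+ 2 / w0 ^+ 2 * (mxtr x ^+ 2 * w0 ^+ 2).
    by field; apply/andP.
  by rewrite (addrI _ eq_c); field; apply/andP.
have eq_c'' : mxc x * mxtr y = mxc y * mxtr x.
  apply: (mulfI (mulf_neq0 b0 trx)).
  apply: (lincomb_eq char2 (lincombD (lincomb1 char2 1 eq_c')
                                     (lincomb1 char2 (mxc x * mxtr y) eq_b'))).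
  ring2 char2.
apply: (mx_commute char2).
- by rewrite mulrC -eq_b' mulrC.
- by rewrite mulrC -eq_c'' mulrC.
apply: (mulfI trx).
apply: (lincomb_eq char2 (lincombD (lincomb1 char2 (mxb x) eq_c'')
                                   (lincomb1 char2 (mxc x) eq_b'))).
ring2 char2.
Qed.

(** Each fibre of the key is a clique that contains two involutions, which serve
    as end points. *)
Lemma flips_nonsplit_ham_path : exists2 s, s \in flips &
  ham_path soladj (flips :|: nonsplit) (mem flips) (pred1 s).
Proof.
have flip_adj : {in flips :|: nonsplit &, forall x y,
    x \in flips -> y \in flips -> x != y -> soladj x y}.
  move=> x y _ _ /flipsP[SLx trx _] /flipsP[SLy tr_y _].
  exact: soladj_involutions.
have [s0 [s0I _ _]] := @flip_exists 0 1 (oner_neq0 _).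
have hamP : ham_path soladj (flips :|: nonsplit) (mem flips) (mem flips).
  apply: (ham_path_fibres (f := key)) => //.
    by apply/set0Pn; exists s0; rewrite inE s0I.
  move=> x /key_has_flip[s sI <-].
  have [s' [s'I neq_s eq_s]] := flip_partner sI.
  have sW : s \in [set y in flips :|: nonsplit | key y == key s].
    by rewrite in_set in_setU sI eqxx.
  have s'W : s' \in [set y in flips :|: nonsplit | key y == key s].
    by rewrite in_set in_setU s'I eq_s eqxx.
  apply: ham_path_weaken (clique_ham_path sW s'W neq_s _).
  - by move=> _ _ /eqP->.
  - by move=> _ _ /eqP->.
  move=> y z /setIdP[/setUP yW /eqP eq_y] /setIdP[/setUP zW /eqP eq_z] neq_yz.
  have eq_yz : key y = key z by rewrite eq_y.
  case: yW => yW; case: zW => zW.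
  - by apply: flip_adj => //; rewrite in_setU ?yW ?zW.
  - exact: soladj_flip_nonsplit.
  - by rewrite soladj_sym; apply: soladj_flip_nonsplit.
  - exact: soladj_nonsplit.
have [x [s [uxs Es pxs xI lI]]] := hamP.
by exists (last x s) => //; exists x, s; split=> //=.
Qed.

End Nonsplit.

(** * The Hamiltonian cycle *)

Section Assembly.

Variables (F : finFieldType) (q : F).
Hypothesis char2 : 2%N \in [pchar F].
Hypotheses (q0 : q != 0) (q1 : q != 1).
Implicit Types (s u x y : {'GL_2[F]}).

Definition lower_involutions : {set {'GL_2[F]}} :=
  [set x in SL 2 F | [&& mxtr x == 0, mxb x == 0 & x != 1%g]].

Lemma lower_involutionsP x : reflect
  [/\ x \in SL 2 F, mxtr x = 0, mxb x = 0 & x != 1%g] (x \in lower_involutions).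
Proof.
rewrite [x \in lower_involutions]in_set.
by apply: (iffP andP) => [[? /and3P[/eqP ? /eqP]]|[? /eqP ? /eqP ? ?]];
  split=> //; apply/and3P.
Qed.

Lemma lower_involutions_fixes x : x \in lower_involutions -> fixes x (1, 0).
Proof.
case/lower_involutionsP=> _ trx bx _.
by rewrite /fixes /= trx bx expr0n mulr0 !mul0r !addr0.
Qed.

Lemma lower_involutions_ham_path :
  ham_path soladj lower_involutions (mem lower_involutions)
           (mem lower_involutions).
Proof.
have transvection c : c != 0 ->
    exists2 x, x \in lower_involutions & mxc x = c.
  move=> c0; have [|x SLx [xa xb xc xd]] := @SL2_exists _ char2 1 0 c 1.
    by rewrite mul0r addr0 mulr1.
  exists x => //; apply/lower_involutionsP; split=> //.
    by rewrite /mxtr xa xd (addrr_pchar2 char2).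
  by apply: contraNneq c0 => x1; rewrite -xc x1 mx1E.
have [x xL xc] := transvection 1 (oner_neq0 _).
have [y yL yc] := transvection q q0.
have neq_xy : x != y by apply: contraNneq q1 => eq_xy; rewrite -yc -eq_xy xc.
apply: ham_path_weaken (clique_ham_path xL yL neq_xy _).
- by move=> _ _ /eqP->.
- by move=> _ _ /eqP->.
move=> u v /lower_involutionsP[SLu tru _ _] /lower_involutionsP[SLv trv _ _].
exact: soladj_involutions.
Qed.

(** The fixed point is found by taking a square root, as the trace is zero. *)
Lemma flip_fixes s : s \in flips F ->
  exists v, [/\ v \in points F, v != (1, 0) & fixes s v].
Proof.
case/flipsP=> SLs trs b0; have [c0|c0] := eqVneq (mxc s) 0.
  exists (0, 1); split; first by rewrite inE eqxx orbT.
    by rewrite xpair_eqE eq_sym oner_eq0.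
  by rewrite /fixes /= trs c0 !mul0r expr0n mulr0 !addr0.
have [t t2] := square_onto char2 (mxb s / mxc s).
exists (1, t); split; first by rewrite inE eqxx.
  by rewrite xpair_eqE eqxx /= -sqrf_eq0 t2 mulf_neq0 ?invr_eq0.
rewrite /fixes /= trs t2 mul0r addr0 expr1n mulr1 mulrC divfK //.
by rewrite (addrr_pchar2 char2).
Qed.

(** The order is: involutions with b = 0, the other involutions mixed with the
    nonsplit elements, split elements. The path through the split elements
    starts at a fixed point of the last involution t and ends at the point
    (1, 0), which is fixed by the first vertex. *)
Lemma SL2_hamiltonian_cycle : exists x c,
  [/\ uniq (x :: c), x :: c =i SL 2 F :\ 1%g, path soladj x c
    & soladj (last x c) x].
Proof.
have [w0 w0_neq0 w0_coset] := artin_schreier_index2 char2.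
have [t tI hamI] := flips_nonsplit_ham_path char2 w0_neq0 w0_coset.
have [v [vP neq_v fixv]] := flip_fixes tI.
have oP : (1, 0) \in points F by rewrite inE eqxx.
have hamS := split_ham_path char2 q0 q1 (subxx _) vP oP neq_v.
have disjIS : [disjoint flips F :|: nonsplit F & split_over (points F)].
  rewrite disjoints_subset; apply/subsetP=> x; rewrite in_setC.
  case/setUP=> [/flipsP[_ trx _]|/nonsplitP[]//].
  by apply/negP=> /splitP[_]; rewrite trx eqxx.
have disjL :
  [disjoint lower_involutions
          & flips F :|: nonsplit F :|: split_over (points F)].
  rewrite disjoints_subset; apply/subsetP=> x /lower_involutionsP[_ trx bx _].
  rewrite in_setC; apply/negP.
  case/setUP=> [/setUP[/flipsP[_ _]|/nonsplitP[_]]|/splitP[_]];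
  by rewrite ?trx ?bx eqxx.
have hamIS : ham_path soladj (flips F :|: nonsplit F :|: split_over (points F))
    (mem (flips F)) (fun y => (y \in split_over (points F)) && fixes y (1, 0)).
  apply: ham_path_cat hamI _ disjIS _.
    by apply: ham_path_weaken hamS => [? _|? ? ?]; [exact: id | exact/andP].
  move=> x y _ yS /eqP-> fy; have [SLt trt _] := flipsP _ tI.
  have [SLy tr_y _] := splitP _ _ yS.
  apply: (soladj_fixes char2 vP) => //.
  by apply: contraNneq tr_y => <-; rewrite trt.
have [x [c [uxc Ec pxc xL lS]]] : ham_path soladj
    (lower_involutions :|: (flips F :|: nonsplit F :|: split_over (points F)))
    (mem lower_involutions)
    (fun y => (y \in split_over (points F)) && fixes y (1, 0)).
  apply: ham_path_cat lower_involutions_ham_path hamIS disjL _.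
  move=> x y _ _ xL yI; have [SLx trx bx _] := lower_involutionsP _ xL.
  have [SLy tr_y by0] := flipsP _ yI.
  apply: (soladj_involutions char2) => //.
  by apply: contraNneq by0 => <-; rewrite bx.
exists x, c; split=> //.
  move=> y; rewrite Ec in_setD1 !in_setU; apply/idP/andP.
    have tr1 : mxtr (1%g : {'GL_2[F]}) = 0.
      by rewrite /mxtr !mx1E (addrr_pchar2 char2).
    case/orP=> [/lower_involutionsP[]//|/orP[/orP[]|]].
    - case/flipsP=> SLy _ by0; split=> //.
      by apply: contraNneq by0 => ->; rewrite mx1E.
    - case/nonsplitP=> SLy tr_y _; split=> //.
      by apply: contraNneq tr_y => ->; rewrite tr1.
    - case/splitP=> SLy tr_y _; split=> //.
      by apply: contraNneq tr_y => ->; rewrite tr1.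
  case=> y1 SLy; have [tr_y|tr_y] := eqVneq (mxtr y) 0.
    have [by0|by0] := eqVneq (mxb y) 0.
      by apply/orP; left; apply/lower_involutionsP.
    by apply/orP; right; apply/orP; left; apply/orP; left; apply/flipsP.
  have [yS|yS] := boolP (y \in split_over (points F)); first by rewrite !orbT.
  by apply/orP; right; apply/orP; left; apply/orP; right; apply/nonsplitP.
have /andP[/splitP[SLl trl _] fixl] := lS.
have [SLx trx _ _] := lower_involutionsP _ xL.
apply: (soladj_fixes char2 oP) => //; first exact: lower_involutions_fixes.
by apply: contraNneq trl => ->; rewrite trx.
Qed.

Lemma SL2_nontrivial_size (c : seq {'GL_2[F]}) :
  c =i SL 2 F :\ 1%g -> (2 < size c)%N.
Proof.
move=> Ec.
have [|x SLx [xa xb xc xd]] := @SL2_exists _ char2 1 1 0 1.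
  by rewrite mulr0 addr0 mulr1.
have [|y SLy [ya yb yc yd]] := @SL2_exists _ char2 1 0 1 1.
  by rewrite mul0r addr0 mulr1.
have [|z SLz [za zb zc zd]] := @SL2_exists _ char2 0 1 1 0.
  by rewrite mul0r add0r mulr1.
have neq (u w : {'GL_2[F]}) (g : {'GL_2[F]} -> F) :
    g u = 1 -> g w = 0 -> u != w.
  move=> gu gw; apply: contraTneq (oner_neq0 F) => eq_uw.
  by rewrite -gu eq_uw gw eqxx.
have uxyz : uniq [:: x; y; z].
  rewrite /= !inE negb_or (neq x y (@mxb F)) ?(neq x z (@mxa F)) //.
  by rewrite (neq y z (@mxa F)).
apply: (uniq_leq_size uxyz) => u; rewrite !inE.
case/or3P=> /eqP->; rewrite Ec in_setD1 ?SLx ?SLy ?SLz andbT.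
- by apply: (neq x _ (@mxb F)); rewrite ?mx1E.
- by apply: (neq y _ (@mxc F)); rewrite ?mx1E.
- by apply: (neq z _ (@mxc F)); rewrite ?mx1E.
Qed.

Lemma SL2_center : 'Z(SL 2 F)%g = 1%g.
Proof.
apply: (SL2_abelian_normal char2 q0 q1); first exact: center_normal.
exact: center_abelian.
Qed.

(** A soluble normal subgroup of the quotient lifts to one of SL(2, F), as the
    centre is soluble. *)
Lemma PSL2_radical : soluble_radical (PSL 2 F) = 1%g.
Proof.
apply/eqP; rewrite -subG1 gen_subG; apply/bigcupsP=> N /andP[nsN solN].
have nZ : 'Z(SL 2 F) <| SL 2 F by exact: center_normal.
have [M defN sZM nsM] := inv_quotientN nZ nsN.
suff M1 : M :=: 1%g by rewrite defN M1 quotient1.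
apply: (SL2_solvable_normal char2 q0 q1) => //.
have nsZM : 'Z(SL 2 F) <| M.
  by apply: normalS sZM _ nZ; apply: normal_sub.
by rewrite (series_sol nsZM) -defN solN abelian_sol // center_abelian.
Qed.

End Assembly.

Theorem theorem4p5 (p : nat) (F : finFieldType)
    (hp : prime p) (hF : #|F| = (2 ^ p)%N) :
  has_hamiltonian_cycle (solubility_vertices (PSL 2 F))
                        (solubility_adj (PSL 2 F)).
Proof.
have char2 : 2%N \in [pchar F] by apply: card_finPcharP hF _.
have [q /andP[q0 q1]] : exists q : F, (q != 0) && (q != 1).
  apply/existsP; rewrite -[X in is_true X]negbK negb_exists.
  apply/negP=> /forallP q01.
  have : (#|F| <= #|[set (0%R : F); 1%R]|)%N.
    apply: subset_leq_card; apply/subsetP=> x _; rewrite !inE.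
    by move: (q01 x); rewrite negb_and !negbK.
  rewrite cards2 hF eq_sym oner_eq0 leqNgt.
  by rewrite (@leq_trans (2 ^ 2)) // leq_exp2l // prime_gt1.
have [x [c [uxc Ec pxc cx]]] := SL2_hamiltonian_cycle char2 q0 q1.
pose f := coset 'Z(SL 2 F).
have Z1 : 'Z(SL 2 F) = 1%g by exact: SL2_center char2 q0 q1.
have sNZ : SL 2 F \subset 'N('Z(SL 2 F)) by apply/normal_norm/center_normal.
have f_inj : {in SL 2 F &, injective f}.
  move=> u w SLu SLw /rcoset_kercosetP.
  rewrite !(subsetP sNZ) // => /(_ isT isT).
  by rewrite /= Z1 => /rcosetP[z /set1P-> ->]; rewrite mul1g.
have VE : solubility_vertices (PSL 2 F) = (SL 2 F / 'Z(SL 2 F) :\ 1)%g.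
  by rewrite /solubility_vertices (PSL2_radical char2 q0 q1).
have f_vertex u : u \in SL 2 F :\ 1%g -> f u \in solubility_vertices (PSL 2 F).
  case/setD1P=> u1 SLu; rewrite VE; apply/setD1P.
  split; last exact: mem_quotient.
  by apply: contraNneq u1 => fu1; apply/eqP/f_inj; rewrite // /f morph1.
have f_adj u w : u \in SL 2 F :\ 1%g -> w \in SL 2 F :\ 1%g -> soladj u w ->
    solubility_adj (PSL 2 F) (f u) (f w).
  move=> Vu Vw /andP[neq_uw sol]; rewrite /solubility_adj !f_vertex //=.
  have [[_ SLu] [_ SLw]] := (setD1P Vu, setD1P Vw).
  apply/andP; split; first by apply: contraNneq neq_uw => /f_inj->.
  have -> : [set f u; f w] = ([set u; w] / 'Z(SL 2 F))%g.
    by rewrite quotientU !quotient_set1 ?(subsetP sNZ).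
  rewrite -quotient_gen; first exact: quotient_sol.
  by rewrite (subset_trans _ sNZ) // subUset !sub1set SLu.
have allV : all [in SL 2 F :\ 1%g] (x :: c) by apply/allP=> u; rewrite Ec.
exists (map f (x :: c)); split.
- by rewrite size_map (SL2_nontrivial_size char2 Ec).
- apply/andP; split.
  + rewrite /= -map_rcons.
    apply: (homo_path_in (P := [in SL 2 F :\ 1%g])) f_adj _ _.
      by rewrite -rcons_cons all_rcons allV andbT; case/andP: allV.
    by rewrite rcons_path pxc.
  + rewrite map_inj_in_uniq // => u w.
    rewrite !Ec => /setD1P[_ SLu] /setD1P[_ SLw].
    exact: f_inj.
move=> z; apply/mapP/idP=> [[u + ->]|]; first by rewrite Ec; apply: f_vertex.
rewrite VE => /setD1P[z1 /morphimP[u _ SLu z_fu]]; exists u => //.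
rewrite Ec; apply/setD1P; split=> //; apply: contraNneq z1 => u1.
by rewrite z_fu u1 morph1.
Qed.
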